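(* The mapping $A\mapsto\hat A$, given by $(\beta,f)\mapsto(\hat\beta,\hat f)$, has a fixed point: there exist a constant $\beta$ and a solution $f$ of the Riccati equation $f_t+f^2=\beta^2+x^2$ (where $x=e^{-t}$) such that $$\hat f=f,\qquad \hat\beta^{\,2}=\beta^2 .$$
   Context: Here $x=e^{-t}$ and subscript $t$ denotes $\frac{d}{dt}$. For a constant $\beta$, let $A=e^{2t}(D_t^2-\beta^2)$, $D_t=\frac{d}{dt}$; the associated Riccati equation (for eigenvalue $\lambda=1$) is $f_t+f^2=\beta^2+x^2$, satisfied by $f=\psi_t/\psi$ when $A\psi=\psi$. The mapping $A\mapsto\hat A$ sends $\beta$ to $\hat\beta=\beta+1$, the operator $A$ to $\hat A=e^{2t}(D_t^2-\hat\beta^2)$, and a solution $f$ of the Riccati equation (with $f+\beta$ nowhere zero) to the function $\hat f$ defined by $(f+\beta)(\hat f-\hat\beta)=x^2$. Since $A$ depends only on $\beta^2$, the condition $\hat\beta^2=\beta^2$ means $\hat A=A$. *)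

(* Defs.v *)
From Stdlib Require Import Reals Lra.
From Coquelicot Require Import Coquelicot.
Open Scope R_scope.

Definition x (t : R) : R := exp (- t).

Definition opA (beta : R) (psi : R -> R) (t : R) : R :=
  exp (2 * t) * (Derive_n psi 2 t - beta ^ 2 * psi t).

(* [Derive_n] is total, so operators are compared only on functions for which
   it is a genuine second derivative. *)
Definition op_eq (P Q : (R -> R) -> R -> R) : Prop :=
  forall psi : R -> R, (forall t, ex_derive_n psi 2 t) ->
  forall t, P psi t = Q psi t.

(* f_t + f^2 = beta^2 + x^2; [is_derive] includes the differentiability of f. *)
Definition riccati_solution (beta : R) (f : R -> R) : Prop :=
  forall t, exists ft, is_derive f t ft /\ ft + f t ^ 2 = beta ^ 2 + x t ^ 2.

(* The condition under which the equation defining [hat_f] can be solved. *)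
Definition nonvanishing_shift (beta : R) (f : R -> R) : Prop :=
  forall t, f t + beta <> 0.

Definition hat_beta (beta : R) : R := beta + 1.

Definition hat_f (beta : R) (f : R -> R) (t : R) : R :=
  hat_beta beta + x t ^ 2 / (f t + beta).

(* [hat_f] is the unique g with (f + beta) (g - hat_beta) = x^2. *)
Lemma hat_fP (beta : R) (f g : R -> R) :
  nonvanishing_shift beta f ->
  (forall t, (f t + beta) * (g t - hat_beta beta) = x t ^ 2) <->
  (forall t, g t = hat_f beta f t).
Proof.
intros H; split; intros E t; specialize (H t); specialize (E t).
- unfold hat_f; rewrite <- E; field; exact H.
- rewrite E; unfold hat_f; field; exact H.
Qed.

(* Main.v *)
Require Import Defs.
From Stdlib Require Import Reals.
From Coquelicot Require Import Coquelicot.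
Open Scope R_scope.

(** The two conditions leave almost no choice.  From (beta + 1)^2 = beta^2 one
    gets beta = -1/2, and then a fixed f must satisfy (f - 1/2)^2 = x^2, that is
    f = 1/2 + x or f = 1/2 - x.  Since x_t = - x, the function f = 1/2 + x has
    f_t + f^2 = - x + (1/4 + x + x^2) = 1/4 + x^2, so it solves the Riccati
    equation; and f + beta = x = exp (- t) never vanishes.  (The other sign gives
    x + (1/4 - x + x^2) and works as well.) *)

Theorem mainTheorem3 :
  exists (beta : R) (f : R -> R),
    riccati_solution beta f /\
    nonvanishing_shift beta f /\
    (forall t : R, hat_f beta f t = f t) /\
    hat_beta beta ^ 2 = beta ^ 2 /\
    op_eq (opA (hat_beta beta)) (opA beta).
Proof.
  exists (- (1 / 2)), (fun t => 1 / 2 + x t).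
  assert (x_neq0 : forall t, x t <> 0)
    by (intro t; apply Rgt_not_eq; apply exp_pos).
  assert (shiftE : forall t, 1 / 2 + x t + - (1 / 2) = x t)
    by (intro t; ring).
  assert (hat_betaE : hat_beta (- (1 / 2)) ^ 2 = (- (1 / 2)) ^ 2)
    by (unfold hat_beta; field).
  split; [| split; [| split; [| split]]].
  - intro t; exists (- x t); split.
    + unfold x; auto_derive; [exact I | ring].
    + field.
  - intro t; rewrite shiftE; apply x_neq0.
  - intro t; unfold hat_f, hat_beta; rewrite shiftE; field; apply x_neq0.
  - exact hat_betaE.
  - intros psi _ t; unfold opA; rewrite hat_betaE; reflexivity.
Qed.
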